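(* Let $V=\{0,1,2,\dots\}$ and let $k_b(x,y)=\sum_{n=0}^{\min(x,y)}\binom{x}{n}\binom{y}{n}$ for $(x,y)\in V\times V$, with reproducing kernel Hilbert space $\mathscr{H}=\mathscr{H}(k_b)$. Let $n\in V$, $F_n=\{0,1,\dots,n\}$ and $x_1\in F_n$. Then $$\left\Vert P_{F_n}(\delta_{x_1})\right\Vert_{\mathscr{H}}^{2}=\sum_{k=x_1}^{n}\binom{k}{x_1}^{2}.$$
   Context: $\mathscr{H}(k_b)$ is the Hilbert space of functions on $V$ with reproducing kernel $k_b$: the completion of $\mathrm{span}\{k_x:x\in V\}$, $k_x=k_b(\cdot,x)$, with $\langle k_x,k_y\rangle_{\mathscr{H}}=k_b(x,y)$. $\delta_{x_1}:V\to\mathbb{C}$ is the function equal to $1$ at $x_1$ and $0$ elsewhere. It is not assumed that $\delta_{x_1}\in\mathscr{H}$; the vector $P_{F_n}(\delta_{x_1})\in\mathrm{span}\{k_y:y\in F_n\}$ is defined by the formula $$P_{F_n}(\delta_{x_1})=\sum_{y\in F_n}\left(K_n^{-1}\delta_{x_1}\right)(y)\,k_y,$$ where $K_n=(k_b(x,y))_{(x,y)\in F_n\times F_n}$, which is an invertible $(n+1)\times(n+1)$ matrix. (For functions in $\mathscr{H}$ the operator $P_{F_n}$ is the orthogonal projection onto $\mathrm{span}\{k_y:y\in F_n\}$.) *)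

(* Defs.v *)
From HB Require Import structures.
From mathcomp Require Import all_boot all_order all_algebra.
From mathcomp Require Import sesquilinear complex.
From mathcomp Require Import boolp classical_sets functions reals topology.
From mathcomp Require Import normedtype.

Set Implicit Arguments.
Unset Strict Implicit.
Unset Printing Implicit Defensive.

Import Order.TTheory GRing.Theory Num.Theory.
Import numFieldNormedType.Exports.

Local Open Scope ring_scope.
Local Open Scope complex_scope.

(* [rkhs k] is the type of complex Hilbert spaces of functions T -> C with
   reproducing kernel k.  Elements are identified with functions through the
   injective linear map [rkhs_fun].  Forms of type [{dot _ for _}] are linear in
   the first argument and conjugate linear in the second one, hence the order of
   the arguments in [rkhs_reproducing].  In particular
   [rkhs_dot (rkhs_sec y) (rkhs_sec x) = k x y], and no nonzero vector is
   orthogonal to all the [rkhs_sec x], i.e., their span is dense. *)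
Record rkhs (R : realType) (T : Type) (k : T -> T -> R[i]) := Rkhs {
  rkhs_space :> completeNormedModType R[i] ;
  rkhs_dot : {dot rkhs_space for (Num.conj : R[i] -> R[i])} ;
  rkhs_normE : forall f : rkhs_space, `|f| ^+ 2 = rkhs_dot f f ;
  rkhs_fun : {linear rkhs_space -> (T -> R[i]^o)} ;
  rkhs_fun_inj : injective rkhs_fun ;
  rkhs_sec : T -> rkhs_space ;
  rkhs_secE : forall x y : T, rkhs_fun (rkhs_sec x) y = k y x ;
  rkhs_reproducing : forall (f : rkhs_space) (x : T),
    rkhs_dot f (rkhs_sec x) = rkhs_fun f x
}.

Definition kb (R : realType) (x y : nat) : R[i] :=
  \sum_(0 <= n < (minn x y).+1) 'C(x, n)%:R * 'C(y, n)%:R.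

(* In what follows F_n = {0, ..., n} is represented by 'I_n.+1. *)
Definition gram (R : realType) (k : nat -> nat -> R[i]) (n : nat) :
    'M[R[i]]_n.+1 :=
  \matrix_(x < n.+1, y < n.+1) k x y.

Definition delta (R : realType) (x y : nat) : R[i] := (y == x)%:R.

(* P_{F_n} f, defined by its formula, so that f : nat -> C need not belong to
   the reproducing kernel Hilbert space. *)
Definition projF (R : realType) (k : nat -> nat -> R[i]) (H : rkhs k)
    (n : nat) (f : nat -> R[i]) : H :=
  \sum_(y < n.+1)
    (invmx (gram k n) *m \col_(x < n.+1) f x) y 0 *: rkhs_sec H y.

(* Main.v *)
Require Import Defs.
From mathcomp Require Import all_boot all_order all_algebra.
From mathcomp Require Import complex reals normedtype.
From mathcomp Require Import sesquilinear.

(** Write [c = K_n^-1 delta_x1] and [p = \sum_y c_y k_y], the vector whose norm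
    is computed.  By the reproducing property [p y = (K_n c) y], so [p] agrees
    with [delta_x1] on [F_n] ([projF_interpolates]).  Expanding the second
    argument of [<p, p>] and using the reproducing property again gives
    [<p, p> = \sum_y conj (c_y) * p y = conj (c_x1)], i.e., the conjugate of
    the diagonal entry [K_n^-1 x1 x1] ([normr_projF_delta]).  This part holds
    for every kernel with an invertible Gram matrix.

    For the binomial kernel, [K_n = L L^T], where [L] is the lower triangular
    Pascal matrix ([gram_kbE]).  Binomial inversion says that the inverse of
    [L] is [L] with signs, [M i j = (-1)^(i + j) 'C(i, j)] ([pascal_mulmxV]).
    Hence [K_n^-1 = M^T M], and its entry at [x1, x1] is the sum of the squares
    of the column [x1] of [M], in which the signs disappear. *)

Set Implicit Arguments.
Unset Strict Implicit.
Unset Printing Implicit Defensive.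

Import GRing.Theory Num.Theory.

Local Open Scope ring_scope.

Lemma coef_1subX_exp (A : comNzRingType) (k j : nat) :
  ((1 - 'X) ^+ k : {poly A})`_j = (-1) ^+ j * 'C(k, j)%:R.
Proof.
rewrite exprBn coef_sum.
under eq_bigr => i _.
  rewrite expr1n mulr1 coefMn -polyC1 -polyCN -rmorphXn coefCM coefXn.
  over.
case: (ltnP j k.+1) => [jk|kj].
  rewrite (bigD1 (Ordinal jk)) //= eqxx mulr1 big1 ?addr0 ?mulr_natr //.
  move=> i neq_ij; rewrite (_ : (j == i) = false) ?mulr0 ?mul0rn //.
  by apply: contra_neqF neq_ij => /eqP ji; apply: val_inj.
rewrite bin_small // mulr0 big1 // => i _.
by rewrite gtn_eqF ?mulr0 ?mul0rn // (leq_trans (ltn_ord i)).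
Qed.

(** Binomial inversion, read off the coefficients of [(1 - (1 - X))^i = X^i].
    The terms with [i < k] vanish, so any upper bound [n >= i] will do. *)
Lemma sum_bin_signed_bin (A : comNzRingType) (i j n : nat) : (i <= n)%N ->
  \sum_(k < n.+1) 'C(i, k)%:R * ((-1) ^+ (k + j) * 'C(k, j)%:R)
    = (i == j)%:R :> A.
Proof.
move=> le_in.
have <- : ((1 - (1 - 'X)) ^+ i : {poly A})`_j = (i == j)%:R.
  by rewrite opprB addrC subrK coefXn eq_sym.
rewrite exprBn coef_sum.
rewrite (big_ord_widen n.+1 (fun k : nat => ((-1) ^+ k * 1 ^+ (i - k) *
   (1 - 'X) ^+ k *+ 'C(i, k) : {poly A})`_j)) ?ltnS // [RHS]big_mkcond /=.
apply: eq_bigr => k _; case: ltnP => [_|ik]; last by rewrite bin_small ?mul0r.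
rewrite expr1n mulr1 coefMn -polyC1 -polyCN -rmorphXn coefCM coef_1subX_exp.
by rewrite exprD mulr_natl mulrA.
Qed.

(** The lower triangular matrix of binomial coefficients with rows and columns
    indexed by [0, ..., n]. *)
Definition pascal_mx (A : comNzRingType) (n : nat) : 'M[A]_n.+1 :=
  \matrix_(i, j) 'C(i, j)%:R.

(** The same matrix with the signs [(-1)^(i + j)], which is its inverse. *)
Definition signed_pascal_mx (A : comNzRingType) (n : nat) : 'M[A]_n.+1 :=
  \matrix_(i, j) ((-1) ^+ (i + j) * 'C(i, j)%:R).

Lemma pascal_mulmxV (A : comNzRingType) (n : nat) :
  pascal_mx A n *m signed_pascal_mx A n = 1%:M.
Proof.
apply/matrixP => i j; rewrite !mxE.
under eq_bigr do rewrite !mxE.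
by rewrite sum_bin_signed_bin // -ltnS.
Qed.

(** The sum defining [kb x y] stops at [minn x y], but may be extended to [n],
    since one of the binomial coefficients vanishes beyond that bound. *)
Lemma gram_kbE (R : realType) (n : nat) :
  gram (@kb R) n = pascal_mx R[i] n *m (pascal_mx R[i] n)^T.
Proof.
apply/matrixP => x y; rewrite !mxE /kb.
under [RHS]eq_bigr do rewrite !mxE.
have le_min : ((minn x y).+1 <= n.+1)%N by rewrite ltnS geq_min -ltnS ltn_ord.
rewrite big_mkord (big_ord_widen n.+1
  (fun k : nat => 'C(x, k)%:R * 'C(y, k)%:R : R[i])) // [LHS]big_mkcond.
apply: eq_bigr => k _; rewrite ltnS leq_min.
case: (leqP k x) => [_|xk] /=; last by rewrite (bin_small xk) mul0r.
by case: (leqP k y) => [_|yk] //; rewrite (bin_small yk) mulr0.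
Qed.

Lemma gram_kb_mulmxV (R : realType) (n : nat) :
  gram (@kb R) n *m ((signed_pascal_mx R[i] n)^T *m signed_pascal_mx R[i] n)
    = 1%:M.
Proof.
have VL := mulmx1C (pascal_mulmxV R[i] n).
rewrite gram_kbE -mulmxA (mulmxA _^T) -trmx_mul VL trmx1 mul1mx.
exact: pascal_mulmxV.
Qed.

Lemma gram_kb_unit (R : realType) (n : nat) : gram (@kb R) n \in unitmx.
Proof. by case: (mulmx1_unit (gram_kb_mulmxV R n)). Qed.

Lemma invmx_gram_kb (R : realType) (n : nat) :
  invmx (gram (@kb R) n)
    = (signed_pascal_mx R[i] n)^T *m signed_pascal_mx R[i] n.
Proof.
by rewrite -[RHS](mulKmx (gram_kb_unit R n)) gram_kb_mulmxV mulmx1.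
Qed.

(** The coefficients of [projF H n f] solve the interpolation problem on
    [F_n], even if [f] is not in the space. *)
Lemma projF_interpolates (R : realType) (k : nat -> nat -> R[i]) (H : rkhs k)
    (n : nat) (f : nat -> R[i]) (y : 'I_n.+1) :
  gram k n \in unitmx ->
  rkhs_fun H (projF H n f) y = f y.
Proof.
move=> gram_unit; set c := invmx (gram k n) *m \col_(x < n.+1) f x.
have -> : rkhs_fun H (projF H n f) y = (gram k n *m c) y 0.
  rewrite mxE -rkhs_reproducing linear_sumlz.
  apply: eq_bigr => z _.
  rewrite linearZl_LR mulrC; congr (_ * _).
  by rewrite mxE -(rkhs_secE H) -rkhs_reproducing.
by rewrite mulKVmx // mxE.
Qed.

Lemma normr_projF_delta (R : realType) (k : nat -> nat -> R[i]) (H : rkhs k)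
    (n : nat) (x : 'I_n.+1) :
  gram k n \in unitmx ->
  `|projF H n (@delta R x)| ^+ 2 = (invmx (gram k n) x x)^*.
Proof.
move=> gram_unit; rewrite rkhs_normE {2}/projF linear_sumr.
set c := invmx (gram k n) *m _.
have -> : (invmx (gram k n) x x)^* = \sum_(y < n.+1) (c y 0)^* * (y == x)%:R.
  rewrite (bigD1 x) //= eqxx mulr1 big1 ?addr0; last first.
    by move=> y /negPf ->; rewrite mulr0.
  rewrite mxE (bigD1 x) //= big1 ?addr0 => [|y /negPf neq_yx].
    by rewrite mxE /delta eqxx mulr1.
  by rewrite mxE /delta -(inj_eq val_inj) /= in neq_yx *; rewrite neq_yx mulr0.
apply: eq_bigr => y _.
by rewrite linearZr_LR /= rkhs_reproducing projF_interpolates.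
Qed.

Theorem theorem3p18 (R : realType) (H : rkhs (@kb R)) (n x1 : nat)
    (hx1 : (x1 <= n)%N) :
  `|projF H n (@delta R x1)| ^+ 2 = \sum_(x1 <= k < n.+1) 'C(k, x1)%:R ^+ 2.
Proof.
have lt_x1 : (x1 < n.+1)%N by [].
rewrite (normr_projF_delta H (Ordinal lt_x1) (gram_kb_unit R n)).
rewrite invmx_gram_kb mxE rmorph_sum /=.
(* On the right, the sum is extended to [0 <= k <= n], where 'C(k, x1) = 0
   for [k < x1]. *)
rewrite [RHS](big_nat_widenl _ 0) // big_mkord [RHS]big_mkcond.
apply: eq_bigr => k _; rewrite !mxE /= mulrACA -expr2 sqrr_sign mul1r.
case: leqP => [_|lt_k]; last by rewrite bin_small // mulr0 conjC0.
by rewrite expr2 rmorphM /= conjC_nat.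
Qed.
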